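(* Let $n\in\mathbb{N}$, let $T_1,\dots,T_n\colon\mathbb{R}^d\to\mathbb{R}^d$ be mappings, let $\xi$ be a random variable taking values in $[n]=\{1,\dots,n\}$, and let $T(\bm{x}) := \mathbb{E}_\xi[T_\xi(\bm{x})]$ for $\bm{x}\in\mathbb{R}^d$. Assume that each $T_i$ ($i\in[n]$) is nonexpansive and that there exists $\sigma\ge 0$ such that $\mathbb{E}_\xi[\|T_\xi(\bm{x})-T(\bm{x})\|^2]\le\sigma^2$ for all $\bm{x}\in\mathbb{R}^d$. Let $(\bm{x}_k)_{k\ge 0}$ be the sequence generated by the mini-batch stochastic Krasnosel'skii-Mann algorithm with initial point $\bm{x}_0\in\mathbb{R}^d$, step sizes $\alpha_k\in(0,1)$ and batch sizes $b_k\in\mathbb{N}$ satisfying $$\sum_{k=0}^{+\infty}\alpha_k(1-\alpha_k)=+\infty \quad\text{and}\quad \sum_{k=0}^{+\infty}\frac{1}{\sqrt{b_k}}<+\infty .$$ Then $(\bm{x}_k)$ converges almost surely to a fixed point of $T$.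
   Context: $\mathbb{R}^d$ carries the Euclidean norm $\|\cdot\|$. A mapping $S\colon\mathbb{R}^d\to\mathbb{R}^d$ is nonexpansive if $\|S(\bm{x})-S(\bm{y})\|\le\|\bm{x}-\bm{y}\|$ for all $\bm{x},\bm{y}\in\mathbb{R}^d$. A fixed point of $T$ is a point $\bm{x}\in\mathbb{R}^d$ with $\bm{x}=T(\bm{x})$. For fixed $\bm{x}$ (independent of $\xi$), $\mathbb{E}_\xi[T_\xi(\bm{x})]=\sum_{i=1}^n T_i(\bm{x})\,\mathrm{P}(\xi=i)$. Mini-batch stochastic Krasnosel'skii-Mann algorithm: given an initial point $\bm{x}_0\in\mathbb{R}^d$, step sizes $\alpha_k\in(0,1)$ and batch sizes $b_k\in\mathbb{N}$, for each $k=0,1,2,\dots$ draw $\bm{\xi}_k=(\xi_{k,1},\dots,\xi_{k,b_k})^\top$ consisting of $b_k$ i.i.d. copies of $\xi$ (sampling with replacement), with $\bm{\xi}_0,\bm{\xi}_1,\dots$ independent (so that $\bm{x}_k$ is independent of $\bm{\xi}_k$), and set $$T_{\bm{\xi}_k}(\bm{x}_k):=\frac{1}{b_k}\sum_{i=1}^{b_k}T_{\xi_{k,i}}(\bm{x}_k),\qquad \bm{x}_{k+1}:=(1-\alpha_k)\bm{x}_k+\alpha_k T_{\bm{\xi}_k}(\bm{x}_k).$$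
   Formalization: The formal theorem additionally assumes that T has at least one fixed point; without this the claim fails, e.g. for n = 1 and T_1(x) = x + c with c ≠ 0. *)

(* Defs.v *)
From HB Require Import structures.
From mathcomp Require Export all_boot all_order all_algebra.
From mathcomp Require Export all_classical all_reals all_analysis.
Export Order.TTheory GRing.Theory Num.Theory.
Export numFieldNormedType.Exports.

Set Implicit Arguments.
Unset Strict Implicit.
Unset Printing Implicit Defensive.

Local Open Scope classical_set_scope.
Local Open Scope ring_scope.

(* Measurable types are pointed, so the index set [n] with n >= 1 is written
   'I_N.+1 with n = N + 1. It carries the discrete sigma-algebra, and batches
   live in m.-tuple 'I_N.+1 with the library's product sigma-algebra. *)
HB.instance Definition _ (N : nat) := isPointed.Build 'I_N.+1 ord0.

HB.instance Definition _ (N : nat) := @isMeasurable.Build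
  default_measure_display 'I_N.+1 discrete_measurable discrete_measurable0
  discrete_measurableC discrete_measurableU.

(* The library norm on row vectors is the sup norm. *)
Definition enorm (R : realType) (d : nat) (x : 'rV[R]_d) : R :=
  Num.sqrt (\sum_(i < d) x 0 i ^+ 2).

Definition nonexpansive (R : realType) (d : nat) (S : 'rV[R]_d -> 'rV[R]_d) :
    Prop :=
  forall x y, enorm (S x - S y) <= enorm (x - y).

Definition mutually_independent (dO : measure_display)
    (Omega : measurableType dO) (R : realType) (P : probability Omega R)
    (I : choiceType) (dT : I -> measure_display)
    (T : forall i, measurableType (dT i)) (X : forall i, Omega -> T i) : Prop :=
  forall (J : seq I) (A : forall i, set (T i)), uniq J ->
    (forall i, i \in J -> measurable (A i)) ->
    P (\bigcap_(i in [set` J]) (X i @^-1` A i))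
      = (\prod_(i <- J) P (X i @^-1` A i))%E.

Definition identically_distributed (d1 d2 : measure_display)
    (Omega1 : measurableType d1) (Omega2 : measurableType d2) (R : realType)
    (P1 : probability Omega1 R) (P2 : probability Omega2 R)
    (d' : measure_display) (T : measurableType d')
    (X : Omega1 -> T) (Y : Omega2 -> T) : Prop :=
  forall A : set T, measurable A -> P1 (X @^-1` A) = P2 (Y @^-1` A).

Definition mean_map (d0 : measure_display) (Omega0 : measurableType d0)
    (R : realType) (P0 : probability Omega0 R) (N d : nat)
    (xi : {RV P0 >-> 'I_N.+1}) (T : 'I_N.+1 -> 'rV[R]_d -> 'rV[R]_d)
    (x : 'rV[R]_d) : 'rV[R]_d :=
  \sum_(i < N.+1) fine (P0 (xi @^-1` [set i])) *: T i x.

Definition batch_map (R : realType) (N d m : nat)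
    (T : 'I_N.+1 -> 'rV[R]_d -> 'rV[R]_d) (s : m.-tuple 'I_N.+1)
    (x : 'rV[R]_d) : 'rV[R]_d :=
  m%:R^-1 *: \sum_(i < m) T (tnth s i) x.

Fixpoint skm (R : realType) (N d : nat) (T : 'I_N.+1 -> 'rV[R]_d -> 'rV[R]_d)
    (alpha : nat -> R) (b : nat -> nat) (s : forall k, (b k).-tuple 'I_N.+1)
    (x0 : 'rV[R]_d) (k : nat) {struct k} : 'rV[R]_d :=
  if k is k'.+1 then
    let x := skm T alpha s x0 k' in
    (1 - alpha k') *: x + alpha k' *: batch_map T (s k') x
  else x0.

(* Main.v *)
Require Import Defs.
From mathcomp Require Import ring lra measurable_realfun.

Set Implicit Arguments.
Unset Strict Implicit.
Unset Printing Implicit Defensive.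

Local Open Scope classical_set_scope.
Local Open Scope ring_scope.

(** Write S for the mean map and e_k for the batch error
    batch_map T (xib k) x_k - S x_k, so that
    x_(k+1) = (1 - alpha_k) x_k + alpha_k S x_k + alpha_k e_k: the algorithm is
    a Krasnosel'skii-Mann iteration of the nonexpansive map S perturbed by
    alpha_k e_k.  The proof separates a pathwise statement from a moment bound,
    and uses no martingale theory.

    Moment bound.  The iterate x_k is a function of the first k batches, hence
    takes finitely many values and is independent of the k-th batch
    ([recursion_indep_next]).  For a fixed point x the error of a batch of size
    b has mean square (variance at x) / b ([batch_map_variance]); conditioning
    on the value of x_k gives E |e_k| <= (sigma + 1) / sqrt b_k.  The right-hand
    side is summable, so by Tonelli the series of the |e_k| converges almost
    surely ([ae_summable]).

    Pathwise statement ([inexact_Krasnoselskii_Mann]).  Suppose that the norms of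
    the perturbations are summable.  For each fixed point q the distance to q
    increases by at most the k-th perturbation at step k, so a tail of the
    perturbations bounds every later increase.  The convexity identity
    [sqr_enorm_convex] moreover shows that the terms
    alpha_k (1 - alpha_k) |x_k - S x_k|^2 are summable; as the
    alpha_k (1 - alpha_k) are not, the residual |x_k - S x_k| is small
    infinitely often.  A cluster point p of the iterates with small residual is
    then a fixed point of S, the distance to p is small infinitely often, and
    it cannot grow again by more than a tail: x_k converges to p. *)

(** * Euclidean norm *)

Lemma enorm_ge0 (R : realType) (d : nat) (x : 'rV[R]_d) : 0 <= enorm x.
Proof. exact: sqrtr_ge0. Qed.

Lemma sqr_enorm (R : realType) (d : nat) (x : 'rV[R]_d) :
  enorm x ^+ 2 = \sum_(i < d) x 0 i ^+ 2.
Proof. by rewrite sqr_sqrtr// sumr_ge0// => i _; exact: sqr_ge0. Qed.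

Lemma abs_coord_le_enorm (R : realType) (d : nat) (x : 'rV[R]_d) (i : 'I_d) :
  `|x 0 i| <= enorm x.
Proof.
rewrite -sqrtr_sqr ler_sqrt; last by rewrite sumr_ge0// => j _; exact: sqr_ge0.
by rewrite (bigD1 i)//= lerDl sumr_ge0// => j _; exact: sqr_ge0.
Qed.

Lemma enorm_eq0 (R : realType) (d : nat) (x : 'rV[R]_d) :
  enorm x = 0 -> x = 0.
Proof.
move=> x0; apply/rowP => i; rewrite mxE; apply/eqP.
by rewrite -normr_le0 -x0 abs_coord_le_enorm.
Qed.

Lemma enorm0 (R : realType) (d : nat) : enorm (0 : 'rV[R]_d) = 0.
Proof.
by rewrite /enorm big1 ?sqrtr0// => i _; rewrite mxE expr0n.
Qed.

Lemma enormZ (R : realType) (d : nat) (a : R) (x : 'rV[R]_d) :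
  enorm (a *: x) = `|a| * enorm x.
Proof.
rewrite /enorm -sqrtr_sqr -sqrtrM ?sqr_ge0//; congr Num.sqrt.
by rewrite mulr_sumr; apply: eq_bigr => i _; rewrite mxE exprMn.
Qed.

Lemma enormN (R : realType) (d : nat) (x : 'rV[R]_d) : enorm (- x) = enorm x.
Proof. by rewrite -scaleN1r enormZ normrN1 mul1r. Qed.

Lemma enormB_sym (R : realType) (d : nat) (x y : 'rV[R]_d) :
  enorm (x - y) = enorm (y - x).
Proof. by rewrite -enormN opprB. Qed.

(** Once both vectors are scaled to norm 1, this is the inequality
    2 u v <= u^2 + v^2 summed over the coordinates. *)
Lemma Cauchy_Schwarz_rV (R : realType) (d : nat) (x y : 'rV[R]_d) :
  \sum_(i < d) x 0 i * y 0 i <= enorm x * enorm y.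
Proof.
have [/eqP/enorm_eq0 ->|x_neq0] := boolP (enorm x == 0).
  by rewrite enorm0 mul0r big1// => i _; rewrite mxE mul0r.
have [/eqP/enorm_eq0 ->|y_neq0] := boolP (enorm y == 0).
  by rewrite enorm0 mulr0 big1// => i _; rewrite mxE mulr0.
have x_gt0 : 0 < enorm x by rewrite lt_def x_neq0 enorm_ge0.
have y_gt0 : 0 < enorm y by rewrite lt_def y_neq0 enorm_ge0.
rewrite -[leRHS]mul1r -ler_pdivrMr ?mulr_gt0// mulr_suml.
have -> : 1 = \sum_(i < d) (x 0 i ^+ 2 / enorm x ^+ 2 / 2
                            + y 0 i ^+ 2 / enorm y ^+ 2 / 2) :> R.
  rewrite big_split/= -!mulr_suml -!sqr_enorm !divff ?sqrf_eq0//.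
  by field.
apply: ler_sum => i _; rewrite -subr_ge0.
have -> : x 0 i ^+ 2 / enorm x ^+ 2 / 2 + y 0 i ^+ 2 / enorm y ^+ 2 / 2
    - x 0 i * y 0 i / (enorm x * enorm y)
    = (x 0 i / enorm x - y 0 i / enorm y) ^+ 2 / 2.
  by field; rewrite x_neq0 y_neq0.
by rewrite divr_ge0// sqr_ge0.
Qed.

Lemma enorm_triangle (R : realType) (d : nat) (x y : 'rV[R]_d) :
  enorm (x + y) <= enorm x + enorm y.
Proof.
rewrite -(@ler_pXn2r _ 2)// ?nnegrE ?addr_ge0 ?enorm_ge0//.
have -> : enorm (x + y) ^+ 2
    = enorm x ^+ 2 + enorm y ^+ 2 + 2 * \sum_(i < d) x 0 i * y 0 i.
  rewrite !sqr_enorm mulr_sumr -!big_split/=; apply: eq_bigr => i _.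
  by rewrite mxE; ring.
have := Cauchy_Schwarz_rV x y; nra.
Qed.

Lemma enorm_sum_le (R : realType) (d : nat) (I : Type) (r : seq I)
    (F : I -> 'rV[R]_d) :
  enorm (\sum_(i <- r) F i) <= \sum_(i <- r) enorm (F i).
Proof.
elim: r => [|i r IHr]; first by rewrite !big_nil enorm0.
by rewrite !big_cons (le_trans (enorm_triangle _ _))// lerD2l.
Qed.

Lemma enorm_le_sum_abs (R : realType) (d : nat) (x : 'rV[R]_d) :
  enorm x <= \sum_(i < d) `|x 0 i|.
Proof.
rewrite -(@ler_pXn2r _ 2)// ?nnegrE ?enorm_ge0 ?sumr_ge0// sqr_enorm.
rewrite [leRHS]expr2 mulr_suml; apply: ler_sum => i _.
rewrite -(real_normK (num_real (x 0 i))) expr2 ler_wpM2l// (bigD1 i)//= lerDl.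
by rewrite sumr_ge0.
Qed.

(** The identity behind the descent of the iteration: averaging two points
    loses exactly a multiple of their squared distance. *)
Lemma sqr_enorm_convex (R : realType) (d : nat) (a : R) (x y : 'rV[R]_d) :
  enorm ((1 - a) *: x + a *: y) ^+ 2
  = (1 - a) * enorm x ^+ 2 + a * enorm y ^+ 2
    - a * (1 - a) * enorm (x - y) ^+ 2.
Proof.
rewrite !sqr_enorm !mulr_sumr -sumrN -!big_split/=; apply: eq_bigr => i _.
by rewrite !mxE; ring.
Qed.

(** * Inexact Krasnosel'skii-Mann iterations *)

(** Finite-dimensional compactness, in the frequently-close form that avoids
    the extraction of a subsequence. *)
Lemma bounded_seq_cluster (R : realType) (d : nat) (y : nat -> 'rV[R]_d)
    (M : R) (y_bnd : forall k, enorm (y k) <= M) :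
  exists p : 'rV[R]_d, forall (e : R) (K : nat), 0 < e ->
    exists2 k, (K <= k)%N & enorm (y k - p) < e.
Proof.
have box_compact : compact [set v : 'rV[R]_d | forall i, `[- M, M]%classic (v ord0 i)].
  by apply (@rV_compact R d (fun=> `[- M, M]%classic)) => i; exact: segment_compact.
have [|p [_ p_cluster]] := box_compact (y @ \oo) _.
  exists 0%N => // k _ /= i; rewrite in_itv/= -ler_norml.
  exact: le_trans (abs_coord_le_enorm _ _) (y_bnd k).
exists p => e K e_gt0.
(* The Euclidean norm is at most d times the largest coordinate; d.+1 keeps the
   quotient meaningful in dimension 0. *)
set c := e / d.+1%:R.
have c_gt0 : 0 < c by rewrite divr_gt0.
have [|_ [[k Kk <-]] ykp] :=
    p_cluster (y @` [set k | (K <= k)%N]) (ball p c) _ (nbhsx_ballx p c c_gt0).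
  by exists K => // k Kk; exists k.
exists k => //; apply: (le_lt_trans (enorm_le_sum_abs _)).
apply: (@le_lt_trans _ _ (\sum_(i < d) c)).
  apply: ler_sum => i _; rewrite !mxE distrC; apply: ltW.
  by have [_ +] := ykp => /(_ 0 i).
rewrite big_const_ord iter_addr_0 -mulr_natr /c -mulrA gtr_pMr//.
by rewrite mulrC ltr_pdivrMr// mul1r ltr_nat.
Qed.

(** One step of the iteration with an error of norm at most e.  The first bound
    is quasi-Fejer monotonicity; the second also records the gain of
    [sqr_enorm_convex], at the price of an error term linear in e once the
    distance to p is bounded. *)
Lemma perturbed_descent (R : realType) (d : nat) (S : 'rV[R]_d -> 'rV[R]_d)
    (S_nonexp : nonexpansive S) (p : 'rV[R]_d) (p_fix : p = S p)
    (a e : R) (a01 : 0 < a < 1) (x x' : 'rV[R]_d)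
    (x'_approx : enorm (x' - ((1 - a) *: x + a *: S x)) <= e) :
  enorm (x' - p) <= enorm (x - p) + e /\
  enorm (x' - p) ^+ 2 <= enorm (x - p) ^+ 2
    - a * (1 - a) * enorm (x - S x) ^+ 2 + (2 * enorm (x - p) + e) * e.
Proof.
set y := (1 - a) *: x + a *: S x in x'_approx *.
have e_ge0 : 0 <= e := le_trans (enorm_ge0 _) x'_approx.
have Sxp : enorm (S x - p) <= enorm (x - p) by rewrite {1}p_fix S_nonexp.
have x'p : enorm (x' - p) <= e + enorm (y - p).
  rewrite -(subrKA y) (le_trans (enorm_triangle _ _))// lerD2r//.
have yp2 : enorm (y - p) ^+ 2 <= enorm (x - p) ^+ 2
    - a * (1 - a) * enorm (x - S x) ^+ 2.
  have -> : y - p = (1 - a) *: (x - p) + a *: (S x - p).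
    by apply/rowP => i; rewrite !mxE; ring.
  rewrite sqr_enorm_convex.
  have -> : x - p - (S x - p) = x - S x by rewrite opprB addrA subrK.
  have := ler_pXn2r (n := 2) isT.
  move/(_ R (enorm (S x - p)) (enorm (x - p))).
  rewrite !nnegrE !enorm_ge0 Sxp => /(_ isT isT) ?.
  nra.
have yp : enorm (y - p) <= enorm (x - p).
  rewrite -(@ler_pXn2r _ 2)// ?nnegrE ?enorm_ge0//.
  by apply: le_trans yp2 _; rewrite gerBl mulr_ge0 ?sqr_ge0//; nra.
split; first by rewrite [leRHS]addrC (le_trans x'p)// lerD2l.
have := enorm_ge0 (x' - p); have := enorm_ge0 (y - p).
nra.
Qed.

(** The residuals need not be shown to tend to 0: it is enough that they are
    small infinitely often, because quasi-Fejer monotonicity turns one close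
    approach to a fixed point, late enough, into convergence. *)
Lemma inexact_Krasnoselskii_Mann (R : realType) (d : nat)
    (S : 'rV[R]_d -> 'rV[R]_d) (S_nonexp : nonexpansive S)
    (S_fixpoint : exists p, p = S p)
    (a : nat -> R) (a01 : forall k, 0 < a k < 1)
    (a_sum : forall C, exists m, C <= \sum_(0 <= k < m) a k * (1 - a k))
    (e : nat -> R) (e_ge0 : forall k, 0 <= e k)
    (e_cvg : cvgn (series e))
    (x : nat -> 'rV[R]_d)
    (x_step : forall k,
       enorm (x k.+1 - ((1 - a k) *: x k + a k *: S (x k))) <= e k) :
  exists2 p, p = S p & enorm (x k - p) @[k --> \oo] --> (0 : R).
Proof.
have fejer q : q = S q -> forall k m, (k <= m)%N ->
    enorm (x m - q) <= enorm (x k - q) + \sum_(k <= i < m) e i.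
  move=> q_fix k; elim=> [|m IHm].
    by rewrite leqn0 => /eqP ->; rewrite big_geq// addr0.
  rewrite leq_eqVlt => /predU1P[<-|]; first by rewrite big_geq// addr0.
  rewrite ltnS => km; rewrite big_nat_recr//= addrA.
  have [+ _] := perturbed_descent S_nonexp q_fix (a01 m) (x_step m).
  by move/le_trans; apply; rewrite lerD2r IHm.
have e_nd : nondecreasing_seq (series e).
  move=> m n mn; apply: (@nondecreasing_series R e xpredT 0%N) mn => k _ _; exact: e_ge0.
pose C := limn (series e).
have e_le k : series e k <= C by exact: nondecreasing_cvgn_le.
have e_tail k m : \sum_(k <= i < m) e i <= C - series e k.
  have [km|/ltnW mk] := leqP k m; last by rewrite big_geq ?subr_ge0.
  by rewrite -sub_series_geq// lerD2r.
have e_leC k : e k <= C.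
  apply: le_trans (e_le k.+1).
  by rewrite /series/= big_nat_recr//= lerDr sumr_ge0.
have [q q_fix] := S_fixpoint.
pose M := enorm (x 0 - q) + C.
have xM k : enorm (x k - q) <= M.
  by rewrite (le_trans (fejer q q_fix 0%N k _))// lerD2l; exact: e_le.
(* Telescoping the squared distances bounds the weighted sum of the squared
   residuals by a constant. *)
have telescoped m : \sum_(0 <= k < m) a k * (1 - a k) * enorm (x k - S (x k)) ^+ 2
    <= enorm (x 0 - q) ^+ 2 - enorm (x m - q) ^+ 2
       + (2 * M + C) * series e m.
  elim: m => [|m IHm].
    by rewrite /series/= !big_geq// subrr mulr0 addr0.
  rewrite /series/= !big_nat_recr//= -/(series e m).
  have [_ ] := perturbed_descent S_nonexp q_fix (a01 m) (x_step m).
  have : (2 * enorm (x m - q) + e m) * e m <= (2 * M + C) * e m.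
    by rewrite ler_wpM2r// lerD// ler_pM2l.
  by move: IHm; rewrite /series/= mulrDr; lra.
(* If all residuals were at least c from K on, the partial sums of
   a k * (1 - a k) would be bounded. *)
have small_residual c K : 0 < c ->
    exists2 k, (K <= k)%N & enorm (x k - S (x k)) < c.
  move=> c_gt0; apply: contrapT => no_k.
  have res_ge k : (K <= k)%N -> c <= enorm (x k - S (x k)).
    by move=> Kk; rewrite leNgt; apply/negP => xk; apply: no_k; exists k.
  have w_ge0 k : 0 <= a k * (1 - a k).
    by have /andP[a0 a1] := a01 k; rewrite mulr_ge0 ?subr_ge0// ltW.
  pose B := enorm (x 0 - q) ^+ 2 + (2 * M + C) * C.
  pose A := \sum_(0 <= k < K) a k * (1 - a k).
  have [m] := a_sum (A + B / c ^+ 2 + 1).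
  apply/negP; rewrite -ltNge.
  have c2_gt0 : 0 < c ^+ 2 by rewrite exprn_gt0.
  have C_ge0 : 0 <= C by apply: le_trans (e_le 0%N); rewrite /series/= big_geq.
  have M_ge0 : 0 <= M by rewrite addr_ge0 ?enorm_ge0.
  have resB : \sum_(0 <= k < m) a k * (1 - a k) * enorm (x k - S (x k)) ^+ 2 <= B.
    apply: (le_trans (telescoped m)); rewrite lerD ?gerBl ?sqr_ge0//.
    by rewrite ler_wpM2l// addr_ge0// mulr_ge0.
  have /le_lt_trans : \sum_(0 <= k < m) a k * (1 - a k) <= A + B / c ^+ 2.
    have [Km|mK] := leqP K m.
      rewrite (big_cat_nat (leq0n K) Km)//= lerD2l ler_pdivlMr//.
      apply: le_trans resB; rewrite (big_cat_nat (leq0n K) Km)//=.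
      apply: (@le_trans _ _ (0 + \sum_(K <= k < m) a k * (1 - a k) * c ^+ 2)).
        by rewrite add0r mulr_suml.
      rewrite lerD//.
        by rewrite sumr_ge0// => k _; rewrite mulr_ge0 ?sqr_ge0.
      apply: ler_sum_nat => k /andP[Kk _].
      rewrite ler_wpM2l// ler_pXn2r ?nnegrE ?enorm_ge0 ?(ltW c_gt0)//.
      exact: res_ge.
    rewrite /A (big_cat_nat (leq0n m) (ltnW mK))//= -addrA lerDl addr_ge0 ?sumr_ge0//.
    rewrite divr_ge0 ?sqr_ge0// addr_ge0 ?sqr_ge0// mulr_ge0// addr_ge0//.
    by rewrite mulr_ge0.
  by apply; rewrite ltrDl.
have /choice[kappa kappaP] : forall j : nat, exists k : nat,
    (j <= k)%N /\ enorm (x k - S (x k)) < j.+1%:R^-1.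
  by move=> j; have [|k] := small_residual j.+1%:R^-1 j; [|exists k].
(* Shifting by q makes xM the bound needed for compactness. *)
have [|p p_cluster] := @bounded_seq_cluster R d (fun j => x (kappa j) - q) M.
  by move=> j; exact: xM.
have {}p_cluster c K : 0 < c ->
    exists2 j, (K <= j)%N & enorm (x (kappa j) - (p + q)) < c.
  by move=> /(p_cluster c K)[j Kj]; rewrite -addrA -opprD [q + p]addrC; exists j.
move: (p + q) p_cluster => {}p p_cluster.
(* x (kappa j) is within c / 3 of p, of its own image, and this image is within
   c / 3 of S p. *)
have p_fix : p = S p.
  apply/eqP; rewrite -subr_eq0; apply/eqP/enorm_eq0/eqP.
  rewrite eq_le enorm_ge0 andbT; apply/ler_addgt0Pr => c c_gt0; rewrite add0r.
  have c3_gt0 : 0 < c / 3 by rewrite divr_gt0.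
  have [K] := ltr_add_invr c3_gt0; rewrite add0r => Kc.
  have [j Kj xjp] := p_cluster (c / 3) K c3_gt0.
  have [_ xj_res] := kappaP j.
  have xj_res' : enorm (x (kappa j) - S (x (kappa j))) < c / 3.
    apply: lt_trans xj_res (le_lt_trans _ Kc).
    by rewrite lef_pV2 ?posrE// ler_nat.
  have Sxj := S_nonexp (x (kappa j)) p.
  have -> : p - S p = (p - x (kappa j)) + (x (kappa j) - S (x (kappa j)))
      + (S (x (kappa j)) - S p) by rewrite !subrKA.
  have := enorm_triangle ((p - x (kappa j)) + (x (kappa j) - S (x (kappa j))))
    (S (x (kappa j)) - S p).
  have := enorm_triangle (p - x (kappa j)) (x (kappa j) - S (x (kappa j))).
  rewrite (enormB_sym p); lra.
(* Half of c for one close approach after K, half for the tail from K on. *)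
exists p => //; apply/cvgrPdist_lt => c c_gt0.
have c2_gt0 : 0 < c / 2 by rewrite divr_gt0.
have /cvgrPdist_lt/(_ _ c2_gt0)[K _ Kc] := e_cvg.
have [j Kj xjp] := p_cluster _ K c2_gt0.
exists (kappa j) => // m /= jm; rewrite sub0r normrN ger0_norm ?enorm_ge0//.
apply: (le_lt_trans (fejer p p_fix _ _ jm)).
rewrite [ltRHS]splitr ltrD//; apply: (le_lt_trans (e_tail _ _)).
have := Kc (kappa j) (leq_trans Kj (kappaP j).1).
by rewrite /= ger0_norm// subr_ge0.
Qed.

(** * Variance of a batch average *)

Lemma sum_tuple_cons (R : nmodType) (I : finType) (m : nat)
    (F : m.+1.-tuple I -> R) :
  \sum_t F t = \sum_j \sum_(t : m.-tuple I) F [tuple of j :: t].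
Proof.
rewrite pair_bigA/= (reindex (fun jt : I * m.-tuple I => [tuple of jt.1 :: jt.2]))//=.
exists (fun t => (thead t, [tuple of behead t])) => [[j t]|t] _ /=.
  by congr pair; apply: val_inj.
by rewrite -tuple_eta.
Qed.

(** The total mass and the first two moments of a sum of m independent centred
    variables, the law of a tuple being the product of the weights p.  The
    three identities are proved together because conditioning on the first
    entry expands the second moment into all of them; the cross term vanishes
    since a has mean 0. *)
Lemma sum_iid_moments (R : comNzRingType) (I : finType) (p a : I -> R)
    (p_sum1 : \sum_j p j = 1) (a_mean0 : \sum_j p j * a j = 0) (m : nat) :
  [/\ \sum_(t : m.-tuple I) \prod_(j <- t) p j = 1,
      \sum_(t : m.-tuple I) (\prod_(j <- t) p j) * \sum_(j <- t) a j = 0 &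
      \sum_(t : m.-tuple I) (\prod_(j <- t) p j) * (\sum_(j <- t) a j) ^+ 2
        = m%:R * \sum_j p j * a j ^+ 2].
Proof.
elim: m => [|m [IH0 IH1 IH2]].
  have tuple0_sum (F : 0.-tuple I -> R) : \sum_t F t = F [tuple].
    by rewrite (big_pred1 [tuple])// => t; apply/esym/eqP/tuple0.
  by rewrite !tuple0_sum !big_nil mulr0 expr0n mulr0 mul0r.
have condition_head (f : R -> R) :
    \sum_(t : m.+1.-tuple I) (\prod_(j <- t) p j) * f (\sum_(j <- t) a j)
    = \sum_j p j * \sum_(t : m.-tuple I)
        (\prod_(i <- t) p i) * f (a j + \sum_(i <- t) a i).
  rewrite sum_tuple_cons; apply: eq_bigr => j _; rewrite mulr_sumr.
  by apply: eq_bigr => t _; rewrite !big_cons mulrA.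
split.
- have := condition_head (fun=> 1).
  under eq_bigr do rewrite mulr1.
  move=> ->; rewrite -[RHS]p_sum1; apply: eq_bigr => j _.
  by under eq_bigr do rewrite mulr1; rewrite IH0 mulr1.
- rewrite (condition_head id) -[RHS]a_mean0; apply: eq_bigr => j _ /=.
  congr (p j * _); under eq_bigr do rewrite mulrDr.
  by rewrite big_split/= -mulr_suml IH0 IH1 mul1r addr0.
- rewrite (condition_head (fun z => z ^+ 2)) -natr1 mulrDl mul1r addrC.
  rewrite -[X in _ = _ + X]mul1r -{2}p_sum1 mulr_suml -big_split/=.
  apply: eq_bigr => j _; rewrite -mulrDr; congr (p j * _).
  have -> : \sum_(t : m.-tuple I)
        (\prod_(i <- t) p i) * (a j + \sum_(i <- t) a i) ^+ 2
      = a j ^+ 2 * \sum_(t : m.-tuple I) \prod_(i <- t) p i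
        + 2 * a j * \sum_(t : m.-tuple I)
            (\prod_(i <- t) p i) * \sum_(i <- t) a i
        + \sum_(t : m.-tuple I)
            (\prod_(i <- t) p i) * (\sum_(i <- t) a i) ^+ 2.
    by rewrite !mulr_sumr -!big_split/=; apply: eq_bigr => t _; ring.
  by rewrite IH0 IH1 IH2 mulr1 mulr0 addr0.
Qed.

Lemma batch_map_variance (R : realType) (N d m : nat)
    (T : 'I_N.+1 -> 'rV[R]_d -> 'rV[R]_d) (p : 'I_N.+1 -> R)
    (p_sum1 : \sum_j p j = 1) (m_gt0 : (0 < m)%N) (x v : 'rV[R]_d)
    (v_mean : v = \sum_j p j *: T j x) :
  \sum_(t : m.-tuple 'I_N.+1)
     (\prod_(j <- t) p j) * enorm (batch_map T t x - v) ^+ 2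
  = m%:R^-1 * \sum_j p j * enorm (T j x - v) ^+ 2.
Proof.
have m_neq0 : m%:R != 0 :> R by rewrite pnatr_eq0 -lt0n.
(* The squared norm is a sum over coordinates, so the scalar case applies to
   each centred coordinate separately. *)
pose a (i : 'I_d) (j : 'I_N.+1) := (T j x - v) 0 i.
have a_mean0 i : \sum_j p j * a i j = 0.
  under eq_bigr => j _ do rewrite /a mxE mulrDr.
  rewrite big_split/= -mulr_suml p_sum1 mul1r v_mean mxE summxE.
  apply/eqP; rewrite subr_eq0; apply/eqP; apply: eq_bigr => j _.
  by rewrite mxE.
have coord (t : m.-tuple 'I_N.+1) i :
    (batch_map T t x - v) 0 i = m%:R^-1 * \sum_(j <- t) a i j.
  rewrite !mxE summxE big_tuple; under [in RHS]eq_bigr do rewrite /a !mxE.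
  rewrite big_split/= sumr_const card_ord -[- v 0 i *+ m]mulr_natl mulrDr.
  by rewrite mulKf.
under eq_bigr => t _ do rewrite sqr_enorm mulr_sumr.
rewrite exchange_big/=.
under [in RHS]eq_bigr => j _ do rewrite sqr_enorm mulr_sumr.
rewrite [in RHS]exchange_big/= mulr_sumr; apply: eq_bigr => i _.
have [_ _ S2] := sum_iid_moments p_sum1 (a_mean0 i) m.
transitivity (m%:R^-1 ^+ 2 * \sum_(t : m.-tuple 'I_N.+1)
    (\prod_(j <- t) p j) * (\sum_(j <- t) a i j) ^+ 2).
  by rewrite mulr_sumr; apply: eq_bigr => t _; rewrite coord; ring.
by rewrite S2 expr2 -mulrA mulKf.
Qed.

(** * Finitely valued random variables *)

(** The iterates live in an uncountable space but take finitely many values.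
    Keeping an explicit list of values turns every integral and conditioning
    argument into a finite sum; V may contain values that are not attained. *)
Definition finitely_valued (dO : measure_display) (Omega : measurableType dO)
    (U : choiceType) (Z : Omega -> U) (V : seq U) : Prop :=
  [/\ uniq V, forall w, Z w \in V & forall v, measurable (Z @^-1` [set v])].

Lemma finitely_valued_preimage (dO : measure_display)
    (Omega : measurableType dO) (U : choiceType) (Z : Omega -> U) (V : seq U)
    (ZV : finitely_valued Z V) (B : set U) : measurable (Z @^-1` B).
Proof.
have [_ Zin Zmeas] := ZV.
have -> : Z @^-1` B = \bigcup_(v in [set` V] `&` B) Z @^-1` [set v].
  apply/seteqP; split=> [w Bw|w [v [_ Bv] /= Zw]].
    by exists (Z w) => //; split => //; exact: Zin.
  by rewrite Zw.
apply: fin_bigcup_measurable => //.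
by apply: finite_setIl; exact: finite_seq.
Qed.

Lemma finitely_valued_measurable (R : realType) (dO : measure_display)
    (Omega : measurableType dO) (U : choiceType) (Z : Omega -> U) (V : seq U)
    (ZV : finitely_valued Z V) (g : U -> R) :
  measurable_fun [set: Omega] (fun w => g (Z w)).
Proof.
move=> _ B mB; rewrite setTI.
exact: (finitely_valued_preimage ZV (g @^-1` B)).
Qed.

Lemma finitely_valued_pair (dO : measure_display) (Omega : measurableType dO)
    (U1 U2 : choiceType) (Z1 : Omega -> U1) (Z2 : Omega -> U2)
    (V1 : seq U1) (V2 : seq U2)
    (ZV1 : finitely_valued Z1 V1) (ZV2 : finitely_valued Z2 V2) :
  finitely_valued (fun w => (Z1 w, Z2 w)) [seq (u, v) | u <- V1, v <- V2].
Proof.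
have [uV1 in1 m1] := ZV1; have [uV2 in2 m2] := ZV2.
split=> [|w|[u v]]; first by apply: allpairs_uniq => // -[? ?] [? ?].
  by apply/allpairsP; exists (Z1 w, Z2 w); split => //=.
rewrite [X in measurable X](_ : _ = Z1 @^-1` [set u] `&` Z2 @^-1` [set v]).
  exact: measurableI.
by apply/seteqP; split=> w /= => [[-> ->]|[-> ->]].
Qed.

Lemma finitely_valued_comp (dO : measure_display) (Omega : measurableType dO)
    (U U' : choiceType) (Z : Omega -> U) (V : seq U)
    (ZV : finitely_valued Z V) (f : U -> U') :
  finitely_valued (fun w => f (Z w)) (undup (map f V)).
Proof.
have [_ Zin _] := ZV; split=> [|w|v]; first exact: undup_uniq.
  by rewrite mem_undup map_f.
exact: (finitely_valued_preimage ZV (f @^-1` [set v])).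
Qed.

Lemma finitely_valued_fin (dO : measure_display) (Omega : measurableType dO)
    (U : finType) (Z : Omega -> U)
    (Z_meas : forall v, measurable (Z @^-1` [set v])) :
  finitely_valued Z (enum U).
Proof. by split=> [|w|//]; rewrite ?enum_uniq ?mem_enum. Qed.

Lemma fine_probK (dO : measure_display) (Omega : measurableType dO)
    (R : realType) (P : probability Omega R) (A : set Omega) :
  measurable A -> (fine (P A))%:E = P A.
Proof. by move=> mA; rewrite fineK// fin_num_measure. Qed.

Lemma prob_partition (dO : measure_display) (Omega : measurableType dO)
    (R : realType) (P : probability Omega R) (U : choiceType) (Z : Omega -> U)
    (V : seq U) (ZV : finitely_valued Z V) (A : set Omega) (mA : measurable A) :
  fine (P A) = \sum_(v <- V) fine (P (A `&` Z @^-1` [set v])).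
Proof.
have [uV Zin Zmeas] := ZV.
apply: EFin_inj; rewrite -sumEFin fine_probK//.
under eq_bigr => v _ do rewrite (fine_probK P (measurableI _ _ mA (Zmeas v))).
rewrite fsbig_seq// -measure_fin_bigcup//.
- congr (P _); apply/seteqP; split=> [w Aw|w [v _ [Aw _]]]; last exact: Aw.
exists (Z w); [exact: Zin|by []].
- exact: trivIset_preimage1_in.
- by move=> v _; exact: measurableI.
Qed.

Lemma prob_partition1 (dO : measure_display) (Omega : measurableType dO)
    (R : realType) (P : probability Omega R) (U : choiceType) (Z : Omega -> U)
    (V : seq U) (ZV : finitely_valued Z V) :
  \sum_(v <- V) fine (P (Z @^-1` [set v])) = 1.
Proof.
have := prob_partition P ZV measurableT; rewrite probability_setT/= => ->.
by apply: eq_bigr => v _; rewrite setTI.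
Qed.

Lemma integral_finitely_valued (dO : measure_display)
    (Omega : measurableType dO) (R : realType) (P : probability Omega R)
    (U : choiceType) (Z : Omega -> U) (V : seq U) (ZV : finitely_valued Z V)
    (g : U -> R) (g_ge0 : forall u, 0 <= g u) :
  (\int[P]_w (g (Z w))%:E
   = (\sum_(v <- V) fine (P (Z @^-1` [set v])) * g v)%:E)%E.
Proof.
have [uV Zin Zmeas] := ZV.
transitivity (\int[P]_w (\sum_(v <- V) (g v)%:E * (\1_(Z @^-1` [set v]) w)%:E))%E.
  apply: eq_integral => w _.
  rewrite (bigD1_seq (Z w))//= indicE mem_set//= mule1 big1 ?adde0//.
  move=> v vZ; rewrite indicE memNset ?mule0// => /= Zv.
  by rewrite Zv eqxx in vZ.
rewrite ge0_integral_sum//.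
- rewrite -sumEFin; apply: eq_bigr => v _.
  rewrite ge0_integralZl_EFin//; last exact/measurable_EFinP/measurable_indic.
  by rewrite integral_indic// setIT EFinM fine_probK// muleC.
- by move=> v; apply/measurable_EFinP; exact: measurable_funM.
- by move=> v w _; rewrite -EFinM lee_fin mulr_ge0.
Qed.

(** Tonelli: the sum of the series has a finite integral, hence is finite almost
    everywhere. *)
Lemma ae_summable (dO : measure_display) (Omega : measurableType dO)
    (R : realType) (P : probability Omega R) (f : nat -> Omega -> R)
    (f_ge0 : forall k w, 0 <= f k w)
    (f_meas : forall k, measurable_fun [set: Omega] (f k))
    (f_sum : (\sum_(0 <= k <oo) \int[P]_w (f k w)%:E < +oo)%E) :
  {ae P, forall w, cvgn (series (fun k => f k w))}.
Proof.
have meas k : measurable_fun [set: Omega] (EFin \o f k).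
  exact/measurable_EFinP.
rewrite -integral_nneseries// in f_sum; last first.
  by move=> k w _; rewrite lee_fin.
have sum_ge0 w : (0 <= \sum_(0 <= k <oo) (f k w)%:E)%E.
  by apply: nneseries_ge0 => k _ _; rewrite lee_fin.
have : P.-integrable [set: Omega] (fun w => \sum_(0 <= k <oo) (f k w)%:E)%E.
  apply/integrableP; split.
    apply: ge0_emeasurable_sum => [k w _ _|k _]; last exact: meas.
    by rewrite lee_fin.
  by under eq_integral => w _ do rewrite gee0_abs//.
move=> /(integrable_ae measurableT); apply: filterS => w /(_ I) fin_sum.
apply: nnseries_is_cvg => //; by rewrite ltey_eq fin_sum.
Qed.

(** * Independence of the past and the next batch *)

Lemma prob_indep (dO : measure_display) (Omega : measurableType dO)
    (R : realType) (P : probability Omega R) (I : choiceType)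
    (dT : I -> measure_display) (E : forall i, measurableType (dT i))
    (Y : forall i, Omega -> E i) (Y_indep : mutually_independent P Y)
    (E_meas : forall i (A : set (E i)), measurable A)
    (Y_meas : forall i (A : set (E i)), measurable (Y i @^-1` A))
    (J : seq I) (A : forall i, set (E i)) (uJ : uniq J) :
  fine (P (\bigcap_(i in [set` J]) (Y i @^-1` A i)))
  = \prod_(i <- J) fine (P (Y i @^-1` A i)).
Proof.
rewrite Y_indep//; apply: EFin_inj; rewrite -prodEFin fineK.
  by apply: eq_bigr => i _; rewrite fine_probK.
by apply: prode_fin_num => i _; rewrite fin_num_measure.
Qed.

(** A random recursion driven by independent variables is, at time k,
    independent of everything that enters from time k on.  The statement keeps
    a whole finite family J of future events because the induction step moves
    the event on Y k from the future into the past. *)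
Lemma recursion_indep_future (dO : measure_display) (Omega : measurableType dO)
    (R : realType) (P : probability Omega R)
    (dT : nat -> measure_display) (E : forall i, measurableType (dT i))
    (Y : forall i, Omega -> E i) (Y_indep : mutually_independent P Y)
    (E_meas : forall i (A : set (E i)), measurable A)
    (W : forall i, seq (E i)) (YW : forall i, finitely_valued (Y i) (W i))
    (U : choiceType) (F : forall k, U -> E k -> U) (x0 : U)
    (X : nat -> Omega -> U) (X0 : forall w, X 0%N w = x0)
    (XS : forall k w, X k.+1 w = F k (X k w) (Y k w)) (k : nat) :
  exists2 V : seq U, finitely_valued (X k) V &
    forall (v : U) (J : seq nat) (A : forall i, set (E i)), uniq J ->
      (forall i, i \in J -> (k <= i)%N) ->
      fine (P (X k @^-1` [set v] `&` \bigcap_(i in [set` J]) (Y i @^-1` A i)))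
      = fine (P (X k @^-1` [set v])) * \prod_(i <- J) fine (P (Y i @^-1` A i)).
Proof.
have Y_meas i (A : set (E i)) : measurable (Y i @^-1` A).
  exact: finitely_valued_preimage (YW i) A.
have cap_meas (J : seq nat) (A : forall i, set (E i)) :
    measurable (\bigcap_(i in [set` J]) (Y i @^-1` A i)).
  by apply: fin_bigcap_measurable => //; exact: finite_seq.
elim: k => [|k [V XV IHk]].
  have X0E v : X 0%N @^-1` [set v] = if x0 == v then setT else set0.
    apply/seteqP; split=> w /=; rewrite X0; first by move=> ->; rewrite eqxx.
    by case: eqP.
  exists [:: x0].
    split=> [//|w|v]; first by rewrite X0 mem_seq1.
    by rewrite X0E; case: ifP.
  move=> v J A uJ _; rewrite X0E; case: ifP => _.
    by rewrite setTI probability_setT mul1r prob_indep.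
  by rewrite set0I measure0 mul0r.
have XYV := finitely_valued_pair XV (YW k).
have XSV : finitely_valued (X k.+1) (undup
    (map (fun ut => F k ut.1 ut.2) [seq (u, t) | u <- V, t <- W k])).
  have := finitely_valued_comp XYV (fun ut => F k ut.1 ut.2).
  by rewrite (_ : (fun w => _) = X k.+1)//; apply/funext => w; rewrite XS.
exists (undup (map (fun ut => F k ut.1 ut.2) [seq (u, t) | u <- V, t <- W k])) => //.
move=> v J A uJ kJ.
pose c (ut : U * E k) := if F k ut.1 ut.2 == v
  then fine (P (X k @^-1` [set ut.1])) * fine (P (Y k @^-1` [set ut.2]))
  else 0.
(* Summing over the values of the pair (X k, Y k) factors out the same sum of
   c whatever J' is; the case J' = [::] identifies it as the law of X k.+1. *)
have condition J' (B : forall i, set (E i)) : uniq J' ->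
    (forall i, i \in J' -> (k < i)%N) ->
    fine (P (X k.+1 @^-1` [set v] `&` \bigcap_(i in [set` J']) (Y i @^-1` B i)))
    = (\sum_(ut <- [seq (u, t) | u <- V, t <- W k]) c ut)
      * \prod_(i <- J') fine (P (Y i @^-1` B i)).
  move=> uJ' kJ'; rewrite (prob_partition P XYV); last first.
    by apply: measurableI => //; exact: finitely_valued_preimage XSV _.
  rewrite mulr_suml; apply: eq_bigr => -[u t] _; rewrite /c/=.
  (* The dependent family B' is B with the event Y k = t added at index k, so
     that the induction hypothesis applies to k :: J'. *)
  pose B' := @dfwith nat (fun i => set (E i)) B k [set t].
  have kJ'N : k \notin J' by apply/negP => /kJ'; rewrite ltnn.
  have B'E i : i \in J' -> B' i = B i.
    move=> iJ'; rewrite /B' dfwithout//.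
    by apply: contraNneq kJ'N => ->.
  have capE : \bigcap_(i in [set` (k :: J')]) (Y i @^-1` B' i)
      = Y k @^-1` [set t] `&` \bigcap_(i in [set` J']) (Y i @^-1` B i).
    rewrite !bigcap_seq big_cons {1}/B' dfwithin; congr (_ `&` _).
    by apply: eq_big_seq => i iJ'; rewrite B'E.
  have [Fv|Fv] := eqVneq (F k u t) v; last first.
    rewrite mul0r [X in P X](_ : _ = set0) ?measure0//.
    rewrite -subset0 => w /= [[Xv _] [Xu Yt]].
    by move/eqP: Fv; apply; rewrite -Xv XS Xu Yt.
  transitivity (fine (P (X k @^-1` [set u]
      `&` \bigcap_(i in [set` (k :: J')]) (Y i @^-1` B' i)))).
    congr (fine (P _)); rewrite capE; apply/seteqP; split=> w /=.
      by move=> [[_ Jw] [-> ->]].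
    by move=> [Xu [Yt Jw]]; rewrite XS Xu Yt.
  rewrite IHk/= ?kJ'N//; last first.
    by move=> i; rewrite inE => /predU1P[->//|/kJ'/ltnW].
  rewrite big_cons {1}/B' dfwithin mulrA; congr (_ * _).
  by apply: eq_big_seq => i iJ'; rewrite B'E.
rewrite condition//.
have := condition [::] A isT; rewrite big_nil mulr1 => <-//.
by rewrite set_nil bigcap_set0 setIT.
Qed.

Lemma recursion_indep_next (dO : measure_display) (Omega : measurableType dO)
    (R : realType) (P : probability Omega R)
    (dT : nat -> measure_display) (E : forall i, measurableType (dT i))
    (Y : forall i, Omega -> E i) (Y_indep : mutually_independent P Y)
    (E_meas : forall i (A : set (E i)), measurable A)
    (W : forall i, seq (E i)) (YW : forall i, finitely_valued (Y i) (W i))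
    (U : choiceType) (F : forall k, U -> E k -> U) (x0 : U)
    (X : nat -> Omega -> U) (X0 : forall w, X 0%N w = x0)
    (XS : forall k w, X k.+1 w = F k (X k w) (Y k w)) (k : nat) :
  exists2 V : seq U, finitely_valued (X k) V &
    forall u t, fine (P (X k @^-1` [set u] `&` Y k @^-1` [set t]))
      = fine (P (X k @^-1` [set u])) * fine (P (Y k @^-1` [set t])).
Proof.
have [V XV indep] := recursion_indep_future Y_indep E_meas YW X0 XS k.
exists V => // u t.
have := indep u [:: k] (@dfwith nat (fun i => set (E i)) (fun=> set0) k [set t]) isT.
rewrite bigcap_seq big_seq1 big_seq1 dfwithin; apply.
by move=> i; rewrite inE => /eqP ->.
Qed.

(** Conditioning on X: a bound on the mean of g u Y that is uniform in u bounds
    the mean of g X Y when X and Y are independent. *)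
Lemma integral_indep_pair_le (dO : measure_display) (Omega : measurableType dO)
    (R : realType) (P : probability Omega R) (U1 U2 : choiceType)
    (X : Omega -> U1) (Y : Omega -> U2) (V : seq U1) (W : seq U2)
    (XV : finitely_valued X V) (YW : finitely_valued Y W)
    (XY_indep : forall u t, fine (P (X @^-1` [set u] `&` Y @^-1` [set t]))
      = fine (P (X @^-1` [set u])) * fine (P (Y @^-1` [set t])))
    (g : U1 -> U2 -> R) (g_ge0 : forall u t, 0 <= g u t) (s : R)
    (g_le : forall u, \sum_(t <- W) fine (P (Y @^-1` [set t])) * g u t <= s) :
  (\int[P]_w (g (X w) (Y w))%:E <= s%:E)%E.
Proof.
have -> : (fun w => (g (X w) (Y w))%:E)
  = (fun w => ((fun ut => g ut.1 ut.2) (X w, Y w))%:E) by [].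
rewrite (integral_finitely_valued P (finitely_valued_pair XV YW)
  (g := fun ut => g ut.1 ut.2))//.
rewrite lee_fin big_allpairs_dep/=.
rewrite -[leRHS]mul1r -(prob_partition1 P XV) mulr_suml.
apply: ler_sum => u _.
apply: le_trans (ler_wpM2l _ (g_le u)); last by rewrite fine_ge0.
rewrite mulr_sumr; apply: ler_sum => t _.
rewrite mulrA -XY_indep le_eqVlt; apply/orP; left; apply/eqP.
congr (fine (P _) * _).
by apply/seteqP; split=> w /= => [[-> ->]|[-> ->]].
Qed.

(** * The batch errors *)

(** Instead of Cauchy-Schwarz: g <= (s + g^2 / s) / 2 pointwise, which averages
    to s. *)
Lemma mean_le_root_mean_sqr (R : realFieldType) (I : Type) (r : seq I)
    (q g : I -> R) (q_ge0 : forall i, 0 <= q i) (q_sum1 : \sum_(i <- r) q i = 1)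
    (s : R) (s_gt0 : 0 < s) (g_sqr : \sum_(i <- r) q i * g i ^+ 2 <= s ^+ 2) :
  \sum_(i <- r) q i * g i <= s.
Proof.
apply: (@le_trans _ _
    (\sum_(i <- r) (q i * (s / 2) + q i * g i ^+ 2 * (2 * s)^-1))).
  apply: ler_sum => i _; rewrite -mulrA -mulrDr ler_wpM2l// -subr_ge0.
  have -> : s / 2 + g i ^+ 2 * (2 * s)^-1 - g i = (g i - s) ^+ 2 / (2 * s).
    by field; rewrite gt_eqF.
  by rewrite divr_ge0 ?sqr_ge0// mulr_ge0// ltW.
rewrite big_split/= -!mulr_suml q_sum1 mul1r.
apply: (@le_trans _ _ (s / 2 + s ^+ 2 * (2 * s)^-1)).
  by rewrite lerD2l ler_wpM2r// invr_ge0 mulr_ge0// ltW.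
by rewrite le_eqVlt; apply/orP; left; apply/eqP; field; rewrite gt_eqF.
Qed.

Lemma nonexpansive_mean (R : realType) (N d : nat) (p : 'I_N.+1 -> R)
    (p_ge0 : forall j, 0 <= p j) (p_sum1 : \sum_j p j = 1)
    (T : 'I_N.+1 -> 'rV[R]_d -> 'rV[R]_d)
    (T_nonexp : forall j, nonexpansive (T j)) :
  nonexpansive (fun x => \sum_j p j *: T j x).
Proof.
move=> x y; rewrite -sumrB; apply: (le_trans (enorm_sum_le _ _)).
rewrite -[leRHS]mul1r -p_sum1 mulr_suml; apply: ler_sum => j _.
by rewrite -scalerBr enormZ ger0_norm// ler_wpM2l// T_nonexp.
Qed.

(** The product sigma-algebra on batches is discrete, because each singleton is
    a finite intersection of coordinate conditions. *)
Lemma measurable_batch (N m : nat) (A : set (m.-tuple 'I_N.+1)) : measurable A.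
Proof.
apply: (finitely_valued_preimage (Z := id) (V := enum {: m.-tuple 'I_N.+1})).
apply: finitely_valued_fin => t.
have -> : id @^-1` [set t] = \bigcap_(i in [set: 'I_m])
    ((fun s : m.-tuple 'I_N.+1 => tnth s i) @^-1` [set tnth t i]).
  apply/seteqP; split=> [s -> //|s st]; apply: eq_from_tnth => i.
  exact: st.
apply: fin_bigcap_measurable => // i _.
by rewrite -[X in measurable X]setTI; apply: measurable_tnth.
Qed.

Lemma batch_law (dO : measure_display) (Omega : measurableType dO)
    (R : realType) (P : probability Omega R)
    (d0 : measure_display) (Omega0 : measurableType d0)
    (P0 : probability Omega0 R) (N m : nat) (xi : {RV P0 >-> 'I_N.+1})
    (Y : {RV P >-> m.-tuple 'I_N.+1})
    (Y_indep : mutually_independent P (fun (i : 'I_m) w => tnth (Y w) i))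
    (Y_law : forall i : 'I_m,
       identically_distributed P P0 (fun w => tnth (Y w) i) xi)
    (t : m.-tuple 'I_N.+1) :
  fine (P (Y @^-1` [set t])) = \prod_(j <- t) fine (P0 (xi @^-1` [set j])).
Proof.
have -> : Y @^-1` [set t] = \bigcap_(i in [set` enum 'I_m])
    ((fun w => tnth (Y w) i) @^-1` [set tnth t i]).
  apply/seteqP; split=> [w /= Yt i _ /=|w Yt]; first by rewrite Yt.
  by apply: eq_from_tnth => i; apply: (Yt i); rewrite /= mem_enum.
have Y_meas (i : 'I_m) (A : set 'I_N.+1) :
    measurable ((fun w => tnth (Y w) i) @^-1` A).
  have -> : (fun w => tnth (Y w) i) @^-1` A
      = Y @^-1` ((fun s : m.-tuple 'I_N.+1 => tnth s i) @^-1` A) by [].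
  rewrite -[X in measurable X]setTI.
  by apply: (measurable_funPT Y) => //; exact: measurable_batch.
rewrite (prob_indep Y_indep _ Y_meas)// ?enum_uniq// big_tuple big_enum/=.
by apply: eq_bigr => i _; rewrite Y_law.
Qed.

(** * Almost sure convergence *)

Theorem theorem3p1 (R : realType) (N d : nat)
  (T : 'I_N.+1 -> 'rV[R]_d -> 'rV[R]_d)
  (d0 : measure_display) (Omega0 : measurableType d0)
  (P0 : probability Omega0 R) (xi : {RV P0 >-> 'I_N.+1})
  (T_nonexpansive : forall i, nonexpansive (T i))
  (T_variance : exists2 sigma : R, 0 <= sigma & forall x : 'rV[R]_d,
     ('E_P0[fun w => (enorm (T (xi w) x - mean_map xi T x) ^+ 2)%R]
        <= (sigma ^+ 2)%R%:E)%E)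
  (T_fixpoint : exists p : 'rV[R]_d, p = mean_map xi T p)
  (x0 : 'rV[R]_d) (alpha : nat -> R) (b : nat -> nat)
  (alpha01 : forall k, 0 < alpha k < 1)
  (b_gt0 : forall k, (0 < b k)%N)
  (dO : measure_display) (Omega : measurableType dO)
  (P : probability Omega R)
  (xib : forall k, {RV P >-> (b k).-tuple 'I_N.+1})
  (xib_indep : mutually_independent P (fun k w => xib k w))
  (xib_batch_indep : forall k,
     mutually_independent P (fun (i : 'I_(b k)) w => tnth (xib k w) i))
  (xib_law : forall k (i : 'I_(b k)),
     identically_distributed P P0 (fun w => tnth (xib k w) i) xi)
  (alpha_sum :
     (\sum_(0 <= k <oo) (alpha k * (1 - alpha k))%R%:E = +oo)%E)
  (b_sum : (\sum_(0 <= k <oo) ((Num.sqrt (b k)%:R)^-1 : R)%R%:E < +oo)%E) :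
  {ae P, forall w, exists2 p : 'rV[R]_d, p = mean_map xi T p &
     enorm (skm T alpha (fun k => xib k w) x0 k - p) @[k --> \oo] --> (0 : R)}.
Proof.
have [sigma sigma_ge0 variance_le] := T_variance.
pose p j := fine (P0 (xi @^-1` [set j])).
have xi_fin : finitely_valued xi (enum 'I_N.+1).
  by apply: finitely_valued_fin => j; exact: measurable_funPTI.
have p_ge0 j : 0 <= p j by rewrite fine_ge0.
have p_sum1 : \sum_j p j = 1 by rewrite -big_enum (prob_partition1 P0 xi_fin).
have variance_sum x :
    \sum_j p j * enorm (T j x - mean_map xi T x) ^+ 2 <= sigma ^+ 2.
  move: (variance_le x); rewrite unlock.
  rewrite (integral_finitely_valued P0 xi_fin
    (g := fun j => enorm (T j x - mean_map xi T x) ^+ 2)); last first.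
    by move=> j; exact: sqr_ge0.
  by rewrite lee_fin big_enum.
(* sigma + 1 rather than sigma makes the bound positive, as
   [mean_le_root_mean_sqr] requires. *)
pose s k := (sigma + 1) / Num.sqrt (b k)%:R.
have s_gt0 k : 0 < s k.
  by rewrite divr_gt0 ?ltr_wpDl// sqrtr_gt0 ltr0n.
pose err k (x : 'rV[R]_d) (t : (b k).-tuple 'I_N.+1) :=
  enorm (batch_map T t x - mean_map xi T x).
have Y_fin k : finitely_valued (xib k) (enum {: (b k).-tuple 'I_N.+1}).
  by apply: finitely_valued_fin => t; apply: measurable_funPTI => //;
     exact: measurable_batch.
have err_mean k x : \sum_(t <- enum {: (b k).-tuple 'I_N.+1})
    fine (P (xib k @^-1` [set t])) * err k x t <= s k.
  apply: mean_le_root_mean_sqr => //.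
  - by move=> t; rewrite fine_ge0.
  - exact: (prob_partition1 P (Y_fin k)).
  - rewrite big_enum/=.
    under eq_bigr => t _ do rewrite (batch_law (xib_batch_indep k) (xib_law k)).
    rewrite (batch_map_variance p_sum1 (b_gt0 k) (T := T) (x := x) (v := mean_map xi T x))//.
    rewrite /s expr_div_n sqr_sqrtr// mulrC ler_wpM2r// ?invr_ge0//.
    apply: (le_trans (variance_sum x)).
    by rewrite ler_pXn2r ?nnegrE ?lerDl ?addr_ge0.
pose X k w := skm T alpha (fun k => xib k w) x0 k.
have X_indep k := recursion_indep_next xib_indep
  (fun k => @measurable_batch N (b k)) Y_fin
  (F := fun k x t => (1 - alpha k) *: x + alpha k *: batch_map T t x)
  (x0 := x0) (X := X) (fun=> erefl) (fun _ _ => erefl) k.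
have err_meas k : measurable_fun [set: Omega] (fun w => err k (X k w) (xib k w)).
  have [V XV _] := X_indep k.
  exact: (finitely_valued_measurable (finitely_valued_pair XV (Y_fin k))
    (fun xt => err k xt.1 xt.2)).
have : {ae P, forall w, cvgn (series (fun k => err k (X k w) (xib k w)))}.
  apply: ae_summable => //; first by move=> k w; exact: enorm_ge0.
  apply: (@le_lt_trans _ _ (\sum_(0 <= k <oo) (s k)%:E)%E).
    apply: lee_nneseries => [k _ _|k _].
      by apply: integral_ge0 => w _; rewrite lee_fin enorm_ge0.
    have [V XV indep] := X_indep k.
    apply: (integral_indep_pair_le XV (Y_fin k) indep (g := err k)).
      by move=> x t; exact: enorm_ge0.
    exact: err_mean.
  under eq_eseriesr => k _ do rewrite /s EFinM.
  rewrite nneseriesZl; last by move=> k _; rewrite lee_fin invr_ge0.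
  have b_ge0 : (0 <= \sum_(0 <= k <oo) ((Num.sqrt (b k)%:R)^-1 : R)%:E)%E.
    by apply: nneseries_ge0 => k _ _; rewrite lee_fin invr_ge0.
  by rewrite lte_mul_pinfty// lee_fin addr_ge0.
apply: filterS => w err_cvg.
apply: (inexact_Krasnoselskii_Mann (nonexpansive_mean p_ge0 p_sum1 T_nonexpansive)
  T_fixpoint alpha01 _ (e := fun k => err k (X k w) (xib k w))) => //.
- move=> C; apply: contrapT => C_ub.
  have : (\sum_(0 <= k <oo) (alpha k * (1 - alpha k))%:E <= C%:E)%E.
    apply: lime_le.
      apply: is_cvg_nneseries => k _ _; have /andP[a0 a1] := alpha01 k.
      by rewrite lee_fin mulr_ge0 ?subr_ge0 ?ltW.
    apply: nearW => m; rewrite sumEFin lee_fin leNgt; apply/negP => /ltW Cm.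
    by apply: C_ub; exists m.
  by rewrite alpha_sum leye_eq.
- by move=> k; exact: enorm_ge0.
- move=> k; have /andP[a0 a1] := alpha01 k.
  have -> : X k.+1 w
      - ((1 - alpha k) *: X k w + alpha k *: mean_map xi T (X k w))
      = alpha k *: (batch_map T (xib k w) (X k w) - mean_map xi T (X k w)).
    by rewrite /= opprD addrACA subrr add0r scalerBr.
  by rewrite enormZ (ger0_norm (ltW a0)) /err ler_piMl ?enorm_ge0 ?(ltW a1).
Qed.
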